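(* Let $V$ be an additive abelian group, $v_0\in V$, and $\underline{D}=(\mathrm{Id}_V,D_1,D_2,\dots)$ a sequence of elements of $\mathrm{End}(V)$ satisfying $D_m(v_0)=0$ for $m\ge 1$. Let $U\subseteq V$ be a subset, and suppose that to each $u\in U$ is attached a field $u(z)=\sum_n u(n)z^{-n-1}\in\mathcal{F}(V)$ such that for all $u,v\in U$: (i) $u(z)\sim v(z)$; (ii) $u(z)v_0\in u+zV[[z]]$; (iii) $[D_m,u(z)]=\sum_{i=1}^m\delta_z^{(i)}u(z)\,D_{m-i}$ for all $m\ge 1$; (iv) $V$ is generated as an additive abelian group by $\{u_1(m_1)\cdots u_k(m_k)v_0\mid u_j\in U,\ m_j\in\mathbf{Z},\ j=1,\dots,k\}$. Then $V=(V,Y,v_0,\underline{D})$ is a vertex ring generated by $U$, with state-field correspondence $Y$ satisfying $Y(u,z)=u(z)$ for $u\in U$, vacuum vector $v_0$, and canonical Hasse--Schmidt derivation $\underline{D}$.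
   Context: $\mathrm{End}(V)$ is the ring of additive endomorphisms of $V$. $\mathcal{F}(V)$ (fields on $V$) is the group of series $a(z)=\sum_{n\in\mathbf{Z}}a(n)z^{-n-1}\in\mathrm{End}(V)[[z,z^{-1}]]$ such that for every $b\in V$, $a(n)b=0$ for all sufficiently large $n$. Write $a(z)\sim b(z)$ (mutually local) if there is an integer $t\ge 0$ with $(z-w)^t[a(z),b(w)]=0$. For $i\ge 0$, $\delta_z^{(i)}a(z):=\sum_n\binom{-n-1}{i}a(n)z^{-n-i-1}$ (the formal ''$\frac1{i!}\partial_z^i$''). Here $\binom{m}{n}=m(m-1)\cdots(m-n+1)/n!$ for $m\in\mathbf{Z}$, $n\ge 1$, and $\binom{m}{0}=1$. A vertex ring is an additive abelian group $V$ with biadditive products $u(n)v$ for all $n\in\mathbf{Z}$ and a distinguished element $\mathbf{1}\in V$ (the vacuum) such that for all $u,v,w\in V$: (a) there is an integer $n_0(u,v)\ge 0$ with $u(n)v=0$ for all $n\ge n_0$; (b) $u(-1)\mathbf{1}=u$ and $u(n)\mathbf{1}=0$ for $n\ge 0$; (c) for all $r,s,t\in\mathbf{Z}$, $\sum_{i\ge 0}\binom{r}{i}(u(t+i)v)(r+s-i)w=\sum_{i\ge 0}(-1)^i\binom{t}{i}\{u(r+t-i)v(s+i)w-(-1)^t v(s+t-i)u(r+i)w\}$. Its state-field correspondence is $u\mapsto Y(u,z)=\sum_n u(n)z^{-n-1}$, and its canonical Hasse--Schmidt derivation is the sequence of endomorphisms $u\mapsto u(-m-1)\mathbf{1}$,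 $m\ge 0$. A subset $U$ generates the vertex ring $V$ if $V$ is generated as an additive abelian group by the elements $u_1(i_1)\cdots u_k(i_k)\mathbf{1}$ with $u_j\in U$, $i_j\in\mathbf{Z}$. *)

(* Defs.v *)
From HB Require Import structures.
From mathcomp Require Export all_boot all_order all_algebra.
From mathcomp Require Export boolp classical_sets functions cardinality fsbigop.
Set Implicit Arguments.
Unset Strict Implicit.
Unset Printing Implicit Defensive.
Import Order.TTheory GRing.Theory Num.Theory.
Local Open Scope classical_set_scope.
Local Open Scope ring_scope.

(* m (m - 1) ... (m - n + 1) / n!; the division is exact. *)
Definition binz (m : int) (n : nat) : int :=
  ((\prod_(i < n) (m - i%:Z)) %/ (n`!)%:Z)%Z.

Section Series.
Variable V : zmodType.

(* A series a(z) = \sum_n a(n) z^(-n-1) with coefficients in End(V) is given by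
   n |-> a(n).  Likewise A : int -> int -> V -> V stands for the two-variable
   series \sum_(m, n) A(m, n) z^(-m-1) w^(-n-1). *)
Local Notation series := (int -> {additive V -> V}).

Record vfield := VField {
  vcoef :> series;
  vcoef_trunc : forall b : V,
    exists N : int, forall n : int, N <= n -> vcoef n b = 0
}.

Definition commutator (a b : series) (m n : int) (x : V) : V :=
  a m (b n x) - b n (a m x).

(* Multiplication by z (resp. w) sends the coefficient of index m + 1 in z
   (resp. n + 1 in w) to index m (resp. n). *)
Definition mul_zBw (A : int -> int -> V -> V) (m n : int) (x : V) : V :=
  A (m + 1) n x - A m (n + 1) x.

Definition mutually_local (a b : series) : Prop :=
  exists t : nat, forall (m n : int) (x : V),
    iter t mul_zBw (commutator a b) m n x = 0.

(* The coefficient of z^(-k-1) comes from the term n = k - i of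
   \sum_n binz (-n-1) i a(n) z^(-n-i-1). *)
Definition hs_deriv (i : nat) (a : series) (k : int) (x : V) : V :=
  a (k - i%:Z) x *~ binz (- (k - i%:Z) - 1) i.

Definition generates_additively (S : set V) : Prop :=
  smallest [set G : set V | GRing.zmod_closed [in G]] S = setT.

(* The elements u_1(m_1) ... u_k(m_k) v0 with k >= 0; k = 0 gives v0. *)
Definition words (U : set V) (a : U -> series) (v0 : V) : set V :=
  [set x | exists s : seq (U * int), x = foldr (fun p => a p.1 p.2) v0 s].

(* vprod u n v is u(n)v; together with vprodDl, the type of vprod expresses
   biadditivity.  By vprod_trunc both sums of vjacobi have finite support, so
   that the finitely supported sums \sum_(i \in setT) are the intended ones. *)
Record vertexRing := VertexRing {
  vprod : V -> series;
  vacuum : V;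
  vprodDl : forall (n : int) (u v w : V),
    vprod (u + v) n w = vprod u n w + vprod v n w;
  vprod_trunc : forall u v : V,
    exists n0 : nat, forall n : int, n0%:Z <= n -> vprod u n v = 0;
  vprod_vacuum : forall u : V,
    vprod u (- 1) vacuum = u /\
    (forall n : int, 0 <= n -> vprod u n vacuum = 0);
  vjacobi : forall (u v w : V) (r s t : int),
    \sum_(i \in [set: nat])
       vprod (vprod u (t + i%:Z) v) (r + s - i%:Z) w *~ binz r i
    = \sum_(i \in [set: nat])
       (vprod u (r + t - i%:Z) (vprod v (s + i%:Z) w)
        - vprod v (s + t - i%:Z) (vprod u (r + i%:Z) w) *~ ((- 1) ^ t))
       *~ ((- 1) ^+ i * binz t i)
}.

Lemma state_field_trunc (W : vertexRing) (u b : V) :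
  exists N : int, forall n : int, N <= n -> vprod W u n b = 0.
Proof. by have [n0 H] := vprod_trunc W u b; exists n0%:Z. Qed.

Definition state_field (W : vertexRing) (u : V) : vfield :=
  VField (state_field_trunc W u).

Definition canonical_hs (W : vertexRing) (m : nat) (u : V) : V :=
  vprod W u (- m%:Z - 1) (vacuum W).

Definition generated_by (W : vertexRing) (U : set V) : Prop :=
  generates_additively (words (fun u : U => vprod W (set_val u)) (vacuum W)).

End Series.

(* Main.v *)
(* Call a field A admissible if it is local to every generating field u(z),
   satisfies A(z) v0 \in V[[z]] and is covariant under D. Covariance determines
   A(z) v0 from A(-1) v0, and locality then determines A(z) on all the words
   spanning V, so A |-> A(-1) v0 is injective on admissible fields. Admissible
   fields are closed under the n-th products A_n B: locality is Dong's lemma.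
   Hence A |-> A(-1) v0 is bijective, its inverse is the state-field
   correspondence Y, and injectivity gives Y(u(n)v) = Y(u)_n Y(v), which is the
   Jacobi identity for r = 0. Both sides of the Jacobi identity satisfy
   X(r + 1, s, t) = X(r, s + 1, t) + X(r, s, t + 1) and agree for large t by
   locality, which gives all other r.
   Instead of manipulating binomial expansions of (z - w)^k for k < 0, identities
   are carried from k = 0 to all k by the injectivity of multiplication by z - w
   on series that have only finitely many negative powers of w. *)
From HB Require Import structures.
Require Import Defs.
From mathcomp Require Import zify ring.
Set Implicit Arguments.
Unset Strict Implicit.
Unset Printing Implicit Defensive.
Import Order.TTheory GRing.Theory Num.Theory.
Local Open Scope classical_set_scope.
Local Open Scope ring_scope.

(** * Binomial coefficients with integer upper argument *)

Lemma falling_prodS (m : int) (n : nat) :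
  \prod_(i < n.+1) (m + 1 - i%:Z) = (m + 1) * \prod_(i < n) (m - i%:Z).
Proof.
rewrite big_ord_recl /= subr0; congr (_ * _); apply: eq_bigr => i _.
by rewrite /bump /= -addn1 PoszD; ring.
Qed.

Lemma falling_prod_pascal (m : int) (n : nat) :
  \prod_(i < n.+1) (m + 1 - i%:Z)
  = \prod_(i < n.+1) (m - i%:Z) + n.+1%:Z * \prod_(i < n) (m - i%:Z).
Proof. by rewrite falling_prodS big_ord_recr /= -addn1 PoszD; ring. Qed.

(** By [falling_prod_pascal] and induction on n, passing from m to m + 1 changes the product of n +
    1 factors by a multiple of (n + 1)!. Divisibility thus spreads both ways from m = 0, where a
    factor is 0. *)
Lemma fact_dvd_falling_prod (m : int) (n : nat) :
  (n`!%:Z %| (\prod_(i < n) (m - i%:Z)))%Z.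
Proof.
elim: n m => [|n IHn] m; first by rewrite fact0.
have step k : (n.+1`!%:Z %| (\prod_(i < n.+1) (k + 1 - i%:Z)))%Z
            = (n.+1`!%:Z %| (\prod_(i < n.+1) (k - i%:Z)))%Z.
  rewrite falling_prod_pascal rpredDr //.
  by rewrite factS PoszM dvdz_mul.
elim/int_ind: m => [|k IHk|k IHk].
- by rewrite big_ord_recl /= subrr mul0r dvdz0.
- by rewrite -[k.+1]addn1 PoszD step.
- by rewrite -step -[k.+1]addn1 PoszD opprD addrNK.
Qed.

Lemma binz_fact (m : int) (n : nat) :
  binz m n * n`!%:Z = \prod_(i < n) (m - i%:Z).
Proof. by rewrite /binz divzK // fact_dvd_falling_prod. Qed.

Lemma binz_eq (m c : int) (n : nat) :
  c * n`!%:Z = \prod_(i < n) (m - i%:Z) -> binz m n = c.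
Proof.
rewrite -binz_fact => /(mulIf _) -> //.
by rewrite eqz_nat -lt0n fact_gt0.
Qed.

Lemma binz0 (m : int) : binz m 0 = 1.
Proof. by apply: binz_eq; rewrite big_ord0. Qed.

Lemma binzS (m : int) (n : nat) :
  binz (m + 1) n.+1 = binz m n.+1 + binz m n.
Proof.
apply: binz_eq.
by rewrite mulrDl binz_fact falling_prod_pascal factS PoszM -(binz_fact m n); ring.
Qed.

Lemma binz_nat_gt (m n : nat) : (m < n)%N -> binz m%:Z n = 0.
Proof.
move=> lt_mn; apply: binz_eq.
by rewrite (bigD1 (Ordinal lt_mn)) //= subrr !mul0r.
Qed.

Lemma binz_nn (n : nat) : binz n%:Z n = 1.
Proof.
elim: n => [|n IHn]; first exact: binz0.
by rewrite -addn1 PoszD addn1 binzS binz_nat_gt // IHn.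
Qed.

(** * Finitely supported sums with binomial weights *)

Section FiniteSums.
Variable V : zmodType.

Lemma fsum_nat (f : nat -> V) (N : nat) :
  (forall i, (N <= i)%N -> f i = 0) -> \sum_(i \in [set: nat]) f i = \sum_(i < N) f i.
Proof.
move=> f0; rewrite fsbig_ord; apply/esym/fsbig_widen => // i /= [_ /negP].
by rewrite -leqNgt => /f0.
Qed.

(** Pascal's rule under the sum; it is the source of every recurrence in an exponent below, negative
    exponents included. *)
Lemma fsum_binzS (f : nat -> V) (k : int) (N : nat) :
  (forall i, (N <= i)%N -> f i = 0) ->
  \sum_(i \in [set: nat]) f i *~ binz (k + 1) i
  = \sum_(i \in [set: nat]) f i *~ binz k i
    + \sum_(i \in [set: nat]) f i.+1 *~ binz k i.
Proof.
move=> f0.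
have f0' g i : (N.+1 <= i)%N -> f i *~ g i = 0 by move=> /ltnW /f0 ->; rewrite mul0rz.
rewrite (fsum_nat (f0' _)) (fsum_nat (f0' _)) (@fsum_nat _ N); last first.
  by move=> i le_Ni; rewrite f0 ?mul0rz // ltnW.
rewrite !big_ord_recl !binz0 -addrA -big_split; congr (_ + _).
by apply: eq_bigr => i _; rewrite /bump /= binzS mulrzDr.
Qed.

Lemma fsum_binz0 (f : nat -> V) :
  \sum_(i \in [set: nat]) f i *~ binz 0 i = f 0%N.
Proof.
rewrite (@fsum_nat _ 1); first by rewrite big_ord1 binz0 mulr1z.
by move=> i i_gt0; rewrite (@binz_nat_gt 0 i).
Qed.

Lemma fsumB (f g : nat -> V) (N : nat) :
  (forall i, (N <= i)%N -> f i = 0) -> (forall i, (N <= i)%N -> g i = 0) ->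
  \sum_(i \in [set: nat]) (f i - g i)
  = \sum_(i \in [set: nat]) f i - \sum_(i \in [set: nat]) g i.
Proof.
move=> f0 g0; rewrite (fsum_nat f0) (fsum_nat g0) (@fsum_nat _ N) ?sumrB //.
by move=> i le_Ni; rewrite f0 ?g0 ?subr0.
Qed.

End FiniteSums.

(** * Multiplication by z - w on two-variable series *)

Section Shifts.
Variable V : zmodType.
Implicit Types (F G : int -> int -> V) (H : int -> int -> int -> V).

Definition mulB F (l n : int) : V := F (l + 1) n - F l (n + 1).

(** Index n belongs to w^(-n-1): only finitely many negative powers of w occur, with a bound uniform
    in l. *)
Definition low_trunc F := exists M : int, forall l n, M <= n -> F l n = 0.

(** If (z - w)F = 0, then F is constant along each line l + n = const, and every such line enters
    the region where F vanishes. *)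
Lemma low_trunc_inj F : low_trunc F -> mulB F = 0 -> F = 0.
Proof.
move=> [M F0] dF; apply/funext => l; apply/funext => n.
have shift (j : nat) : F l n = F (l - j%:Z) (n + j%:Z).
  elim: j => [|j ->]; first by rewrite subr0 addr0.
  have /subr0_eq := congr1 (fun G => G (l - j.+1%:Z) (n + j%:Z)) dF.
  by rewrite -addn1 PoszD !addrA opprD !addrA subrK.
by rewrite (shift `|M - n|%N) F0 //; lia.
Qed.

Lemma low_trunc_iter_inj F t :
  low_trunc F -> iter t mulB F = 0 -> F = 0.
Proof.
elim: t F => [|t IHt] F trF // ; rewrite iterSr => /IHt d0.
apply: low_trunc_inj => //; apply: d0; case: trF => M F0; exists M => l n le_Mn.
by rewrite /mulB !F0 ?subr0 //; lia.
Qed.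

(** Applying [mulB] carries the vanishing from k to k + 1; its injectivity carries it from k to k -
    1. *)
Lemma low_trunc_family0 (E : int -> int -> int -> V) :
  (forall k, low_trunc (E k)) -> (forall k, E (k + 1) = mulB (E k)) -> E 0 = 0 ->
  forall k, E k = 0.
Proof.
move=> trE dE E0; elim/int_ind => [//|k IHk|k IHk].
  rewrite -addn1 PoszD dE IHk; apply/funext => l; apply/funext => n.
  exact: subrr.
apply: low_trunc_inj => //.
by rewrite -dE -addn1 PoszD opprD addrNK.
Qed.

End Shifts.

(** * Formal series in several variables *)

Lemma subrACA (V : zmodType) (x y z t : V) : x - y - (z - t) = x - z - (y - t).
Proof. by rewrite opprD addrACA -opprD. Qed.

Lemma fct_mulrzE (T : Type) (M : zmodType) (f : T -> M) (n : int) (x : T) :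
  (f *~ n) x = f x *~ n.
Proof.
have natE (m : nat) : (f *+ m) x = f x *+ m by elim: m => // m IHm; rewrite !mulrS -IHm.
by case: n => n; rewrite ?NegzE ?mulrNz -?pmulrn -?natE.
Qed.

Section IteratedOperators.
Variable M : zmodType.
Implicit Types a b c : {additive M -> M}.

Lemma iter_raddf0 a t : iter t a 0 = 0.
Proof. by elim: t => //= t ->; rewrite raddf0. Qed.

Lemma iter_raddfB a t (x y : M) : iter t a (x - y) = iter t a x - iter t a y.
Proof. by elim: t => //= t ->; rewrite raddfB. Qed.

Lemma iter_raddfD a t (x y : M) : iter t a (x + y) = iter t a x + iter t a y.
Proof. by elim: t => //= t ->; rewrite raddfD. Qed.

Lemma iter_raddfMz a t (x : M) (n : int) : iter t a (x *~ n) = iter t a x *~ n.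
Proof. by elim: t => //= t ->; rewrite raddfMz. Qed.

Lemma iter_comm (T : Type) (f g : T -> T) t (x : T) :
  (forall y, f (g y) = g (f y)) -> iter t f (g x) = g (iter t f x).
Proof. by move=> fg; elim: t => //= t ->. Qed.

Lemma iter_iter_comm (T : Type) (f g : T -> T) s t (x : T) :
  (forall y, f (g y) = g (f y)) -> iter s f (iter t g x) = iter t g (iter s f x).
Proof. by move=> fg; elim: t => //= t <-; rewrite iter_comm. Qed.

Lemma iter_raddf_ge0 a s t (x : M) :
  (s <= t)%N -> iter s a x = 0 -> iter t a x = 0.
Proof. by move=> /subnK <- x0; rewrite iterD x0 iter_raddf0. Qed.

(** Every term of (b - a)^(p+q) contains a^p or b^q. The double induction peels off one factor b - a
    at a time. *)
Lemma nilpotent_sub a b c p q (x : M) :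
  (forall y, a (b y) = b (a y)) -> (forall y, c y = b y - a y) ->
  iter p a x = 0 -> iter q b x = 0 -> iter (p + q) c x = 0.
Proof.
move=> ab cE; elim: p q x => [|p IHp] q x.
  by move=> /= -> _; rewrite iter_raddf0.
elim: q x => [|q IHq] x.
  by move=> _; rewrite [iter 0 _ _]/= => ->; rewrite iter_raddf0.
move=> ax bx; rewrite addSn iterSr cE iter_raddfB [X in _ - X]IHp ?subr0.
- by rewrite addnS -addSn IHq -?iterSr // iter_comm // ax raddf0.
- by rewrite -iterSr.
- by rewrite iter_comm // bx raddf0.
Qed.

End IteratedOperators.

Section ThreeVariables.
Variable V : zmodType.
Local Notation series2 := (int -> int -> V).
Local Notation series3 := (int -> int -> int -> V).
Implicit Types (F : series2) (H : series3).

(** With l, m, n the indices of the variables z, w, x, these are the multiplications by z - w, z - x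
    and w - x. *)
Definition mulB12 H (l m n : int) : V := H (l + 1) m n - H l (m + 1) n.
Definition mulB13 H (l m n : int) : V := H (l + 1) m n - H l m (n + 1).
Definition mulB23 H (l m n : int) : V := H l (m + 1) n - H l m (n + 1).

Lemma mulB_is_additive : zmod_morphism (@mulB V).
Proof.
move=> F G; apply/funext => l; apply/funext => m.
by rewrite /mulB !fctE subrACA.
Qed.
HB.instance Definition _ :=
  GRing.isZmodMorphism.Build series2 series2 (@mulB V) mulB_is_additive.

Lemma mulB12_is_additive : zmod_morphism mulB12.
Proof.
move=> F G; apply/funext => l; apply/funext => m; apply/funext => n.
by rewrite /mulB12 !fctE subrACA.
Qed.
HB.instance Definition _ :=
  GRing.isZmodMorphism.Build series3 series3 mulB12 mulB12_is_additive.

Lemma mulB13_is_additive : zmod_morphism mulB13.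
Proof.
move=> F G; apply/funext => l; apply/funext => m; apply/funext => n.
by rewrite /mulB13 !fctE subrACA.
Qed.
HB.instance Definition _ :=
  GRing.isZmodMorphism.Build series3 series3 mulB13 mulB13_is_additive.

Lemma mulB23_is_additive : zmod_morphism mulB23.
Proof.
move=> F G; apply/funext => l; apply/funext => m; apply/funext => n.
by rewrite /mulB23 !fctE subrACA.
Qed.
HB.instance Definition _ :=
  GRing.isZmodMorphism.Build series3 series3 mulB23 mulB23_is_additive.

Lemma mulB12_13 H : mulB12 (mulB13 H) = mulB13 (mulB12 H).
Proof.
apply/funext => l; apply/funext => m; apply/funext => n.
by rewrite /mulB12 /mulB13 subrACA.
Qed.

Lemma mulB12_23 H : mulB12 (mulB23 H) = mulB23 (mulB12 H).
Proof.
apply/funext => l; apply/funext => m; apply/funext => n.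
by rewrite /mulB12 /mulB23 subrACA.
Qed.

Lemma mulB13_23 H : mulB13 (mulB23 H) = mulB23 (mulB13 H).
Proof.
apply/funext => l; apply/funext => m; apply/funext => n.
by rewrite /mulB13 /mulB23 subrACA.
Qed.

Lemma mulB23E H : mulB23 H = mulB13 H - mulB12 H.
Proof.
apply/funext => l; apply/funext => m; apply/funext => n.
by rewrite /mulB23 /mulB12 /mulB13 !fctE subrACA subrr sub0r opprB.
Qed.

Lemma iter_mulB13 t H l m n :
  iter t mulB13 H l m n = iter t (@mulB V) (fun l' n' => H l' m n') l n.
Proof. by elim: t l n => //= t IHt l n; rewrite /mulB13 /mulB !IHt. Qed.

Lemma iter_mulB23 t H l m n :
  iter t mulB23 H l m n = iter t (@mulB V) (H l) m n.
Proof. by elim: t m n => //= t IHt m n; rewrite /mulB23 /mulB !IHt. Qed.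

Definition swap12 H (l m n : int) : V := H m l n.

Lemma iter_mulB13_swap t H : iter t mulB13 (swap12 H) = swap12 (iter t mulB23 H).
Proof. by elim: t => //= t ->. Qed.

Lemma iter_mulB23_swap t H : iter t mulB23 (swap12 H) = swap12 (iter t mulB13 H).
Proof. by elim: t => //= t ->. Qed.

Lemma iter_mulB_swap t F l m :
  iter t (@mulB V) (fun l' m' => F m' l') l m = iter t (@mulB V) F m l *~ (-1) ^+ t.
Proof.
elim: t l m => [|t IHt] l m; first by rewrite mulr1z.
by rewrite !iterS /mulB !IHt -mulrzBl exprS mulN1r mulrNz -mulNrz opprB.
Qed.

Lemma iter_mulB_raddf (f : {additive V -> V}) t F l m :
  iter t (@mulB V) (fun l' m' => f (F l' m')) l m = f (iter t (@mulB V) F l m).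
Proof. by elim: t l m => //= t IHt l m; rewrite /mulB !IHt raddfB. Qed.

(** The third index is fixed first because the bound may depend on it: later a product is applied to
    [C n x], which varies with n. *)
Definition low_trunc3 H := forall n, low_trunc (fun l m => H l m n).

Lemma low_trunc3_mulB13 H : low_trunc3 H -> low_trunc3 (mulB13 H).
Proof.
move=> trH n; have [M HM] := trH n; have [M' HM'] := trH (n + 1).
exists (Num.max M M') => l m; rewrite ge_max => /andP[le1 le2].
by rewrite /mulB13 HM ?HM' ?subr0.
Qed.

Lemma low_trunc3_mulB23 H : low_trunc3 H -> low_trunc3 (mulB23 H).
Proof.
move=> trH n; have [M HM] := trH n; have [M' HM'] := trH (n + 1).
exists (Num.max M M') => l m; rewrite ge_max => /andP[le1 le2].
by rewrite /mulB23 HM ?HM' ?subr0 //; lia.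
Qed.

End ThreeVariables.

(** * Mutual locality of fields *)

Section Locality.
Variable V : zmodType.
Implicit Types A B C : vfield V.

Lemma mutually_localE A B :
  mutually_local A B <->
  exists t, forall x, iter t (@mulB V) (fun m n => commutator A B m n x) = 0.
Proof.
have iterE t (K : int -> int -> V -> V) m n x :
    iter t (@mul_zBw V) K m n x = iter t (@mulB V) (fun m n => K m n x) m n.
  by elim: t m n => //= t IHt m n; rewrite /mul_zBw /mulB !IHt.
split=> -[t H]; exists t.
  by move=> x; apply/funext => m; apply/funext => n; rewrite -iterE H.
by move=> m n x; rewrite iterE H.
Qed.

Lemma mutually_local_sym A B : mutually_local A B -> mutually_local B A.
Proof.
move=> /mutually_localE[t AB]; apply/mutually_localE; exists t => x.
apply/funext => m; apply/funext => n.
have -> : (fun m n => commutator B A m n x)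
        = fun m n => (- (fun m' n' => commutator A B m' n' x)) n m.
  by apply/funext => m'; apply/funext => n'; rewrite !fctE /commutator opprB.
by rewrite iter_mulB_swap -sub0r iter_raddfB AB iter_raddf0 subr0 mul0rz.
Qed.

End Locality.

(** * Products of fields and Dong's lemma *)

Section Products.
Variable V : zmodType.
Implicit Types A B C : vfield V.

(* The coefficient of z^(-l-1) w^(-m-1) in (z - w)^k A(z) B(w), where (z - w)^k
   is expanded in nonnegative powers of w. *)
Definition ordered_prod A B (k l m : int) (x : V) : V :=
  \sum_(i \in [set: nat]) A (l + k - i%:Z) (B (m + i%:Z) x) *~ ((- 1) ^+ i * binz k i).

Lemma coef_eventually0 A (m : int) (x : V) :
  exists N : nat, forall i : nat, (N <= i)%N -> A (m + i%:Z) x = 0.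
Proof.
have [N HN] := vcoef_trunc A x; exists `|N - m|%N => i le_i.
by apply: HN; lia.
Qed.

Lemma ordered_prodS A B k l m x :
  ordered_prod A B (k + 1) l m x
  = ordered_prod A B k (l + 1) m x - ordered_prod A B k l (m + 1) x.
Proof.
have [N HN] := coef_eventually0 B m x.
pose f i := A (l + (k + 1) - i%:Z) (B (m + i%:Z) x) *~ (- 1) ^+ i.
have f0 i : (N <= i)%N -> f i = 0 by move=> /HN e; rewrite /f e raddf0 mul0rz.
have HS c : \sum_(i \in [set: nat]) f i *~ binz c i
    = \sum_(i \in [set: nat])
        A (l + (k + 1) - i%:Z) (B (m + i%:Z) x) *~ ((- 1) ^+ i * binz c i).
  by apply: eq_fsbigr => i _; rewrite mulrzA.
rewrite {1}/ordered_prod -HS (fsum_binzS _ f0) HS; congr (_ + _).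
  by apply: eq_fsbigr => i _; congr (vcoef A _ _ *~ _); lia.
rewrite /ordered_prod !(@fsum_nat _ _ N); first last.
- by move=> i le_i; rewrite f0 ?mul0rz //; lia.
- move=> i /leqW /HN e; have -> : m + 1 + i%:Z = m + i.+1%:Z by lia.
  by rewrite e raddf0 mul0rz.
rewrite -sumrN; apply: eq_bigr => i _; rewrite /f -mulrzA exprS mulN1r mulNr mulrNz.
by congr (- (vcoef A _ (vcoef B _ _) *~ _)); lia.
Qed.

Lemma ordered_prod0 A B l m x : ordered_prod A B 0 l m x = A l (B m x).
Proof.
rewrite -[RHS](_ : A (l + 0 - 0%:Z) (B (m + 0%:Z) x) *~ (- 1) ^+ 0 = _).
  rewrite -[RHS](fsum_binz0 (fun i => A (l + 0 - i%:Z) (B (m + i%:Z) x) *~ (- 1) ^+ i)).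
  by apply: eq_fsbigr => i _; rewrite mulrzA.
by rewrite subr0 !addr0.
Qed.

(** Every term contains B(m + i) with i >= 0, so the truncation of B on x alone bounds m. *)
Lemma ordered_prod_low_trunc A B k x : low_trunc (fun l m => ordered_prod A B k l m x).
Proof.
have [N HN] := vcoef_trunc B x; exists N => l m le_Nm.
by apply: fsbig1 => i _; rewrite HN ?raddf0 ?mul0rz //; lia.
Qed.

Lemma ordered_prodB A B k l m : zmod_morphism (ordered_prod A B k l m).
Proof.
move=> x y; have [N HN] := coef_eventually0 B m x.
have [N' HN'] := coef_eventually0 B m y.
rewrite -(@fsumB _ _ _ (maxn N N')).
- by apply: eq_fsbigr => i _; rewrite !raddfB mulrzBl.
- by move=> i; rewrite geq_max => /andP[le _]; rewrite HN ?raddf0 ?mul0rz.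
- by move=> i; rewrite geq_max => /andP[_ le]; rewrite HN' ?raddf0 ?mul0rz.
Qed.

(* The coefficient of z^(-l-1) w^(-m-1) in (z - w)^k [A(z), B(w)], each of the
   two products being expanded in its own domain: this is the right-hand side of
   the Jacobi identity with (r, s, t) = (l, m, k). *)
Definition expanded_comm A B (k l m : int) (x : V) : V :=
  ordered_prod A B k l m x - ordered_prod B A k m l x *~ (- 1) ^ k.

Lemma expN1zS (k : int) : (- 1 : int) ^ (k + 1) = - (- 1) ^ k.
Proof. by rewrite exprzDr // expr1z mulrN1. Qed.

Lemma expanded_commS A B k l m x :
  expanded_comm A B (k + 1) l m x
  = expanded_comm A B k (l + 1) m x - expanded_comm A B k l (m + 1) x.
Proof.
rewrite /expanded_comm !ordered_prodS subrACA expN1zS mulrNz -mulNrz opprB.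
by rewrite mulrzBl.
Qed.

Lemma expanded_comm0 A B l m x : expanded_comm A B 0 l m x = commutator A B l m x.
Proof. by rewrite /expanded_comm !ordered_prod0. Qed.

(** For k >= 0 both expansions of (z - w)^k agree, so this is the k-fold multiple of the commutator
    by z - w. *)
Lemma expanded_comm_local A B :
  mutually_local A B ->
  exists N : nat, forall k : int, N%:Z <= k ->
    forall l m x, expanded_comm A B k l m x = 0.
Proof.
move=> /mutually_localE[N AB]; exists N => k le_Nk l m x.
have iterE (j : nat) l' m' : expanded_comm A B j l' m' x
    = iter j (@mulB V) (fun l m => commutator A B l m x) l' m'.
  elim: j l' m' => [|j IHj] l' m'; first exact: expanded_comm0.
  by rewrite -addn1 PoszD expanded_commS addn1 /= /mulB -!IHj.
case: k le_Nk => // j le_Nj.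
by rewrite iterE (@iter_raddf_ge0 _ _ N).
Qed.

(** Index 0 in z is the coefficient of z^(-1): this residue is the k-th product of the two
    fields. *)
Definition nprod_coef A B (k m : int) (x : V) : V := expanded_comm A B k 0 m x.

Lemma nprod_coef_is_additive A B k m : zmod_morphism (nprod_coef A B k m).
Proof.
move=> x y.
by rewrite /nprod_coef /expanded_comm !ordered_prodB mulrzBl subrACA.
Qed.

HB.instance Definition _ A B k m :=
  GRing.isZmodMorphism.Build V V (nprod_coef A B k m)
    (nprod_coef_is_additive A B k m).

Lemma nprod_trunc A B k (b : V) :
  exists N : int, forall m : int, N <= m -> nprod_coef A B k m b = 0.
Proof.
have [M HM] := ordered_prod_low_trunc A B k b.
have [N HN] := coef_eventually0 A 0 b.
(* In the reversed product only the vectors A(i)b with i < N survive; P is a common truncation bound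
   of B on these finitely many vectors. *)
have [P HP] : exists P : int, forall (i : nat) n, (i < N)%N -> P <= n ->
    B n (A (0 + i%:Z) b) = 0.
  elim: (N) => [|N' [P HP]]; first by exists 0.
  have [Q HQ] := vcoef_trunc B (A (0 + N'%:Z) b).
  exists (Num.max P Q) => i n; rewrite ltnS leq_eqVlt ge_max => /orP[/eqP ->|lti] /andP[leP leQ].
    exact: HQ.
  exact: HP.
(* In the reversed product the index of B is m + k - i with i < N. *)
exists (Num.max M (P + N%:Z - k)) => m; rewrite ge_max => /andP[leM leP].
rewrite /nprod_coef /expanded_comm HM // sub0r.
rewrite [ordered_prod _ _ _ _ _ _]fsbig1 ?mul0rz ?oppr0 // => i _.
have [le_Ni|lt_iN] := leqP N i; first by rewrite HN // raddf0 mul0rz.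
by rewrite HP ?mul0rz //; lia.
Qed.

Definition nprod A B (k : int) : vfield V :=
  VField (vcoef := fun m => nprod_coef A B k m) (nprod_trunc A B k).

(** For k = 0, [AB, C] = A[B, C] + [A, C]B is killed by (z - x)^p (w - x)^q. These factors commute
    with z - w, so [low_trunc_family0], with the index of x fixed, reaches every k with the same p
    and q. *)
Lemma ordered_prod_comm_local A B C p q x k :
  (forall y, iter p (@mulB V) (fun m n => commutator A C m n y) = 0) ->
  (forall y, iter q (@mulB V) (fun m n => commutator B C m n y) = 0) ->
  iter p (@mulB13 V) (iter q (@mulB23 V)
    (fun l m n => ordered_prod A B k l m (C n x) - C n (ordered_prod A B k l m x)))
  = 0.
Proof.
move=> AC BC.
pose K k l m n := ordered_prod A B k l m (C n x) - C n (ordered_prod A B k l m x).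
pose E k := iter p (@mulB13 V) (iter q (@mulB23 V) (K k)).
have KS k' : K (k' + 1) = mulB12 (K k').
  apply/funext => l; apply/funext => m; apply/funext => n.
  by rewrite /K /mulB12 !ordered_prodS raddfB subrACA.
have ES k' : E (k' + 1) = mulB12 (E k').
  rewrite /E KS (iter_comm _ _ (fun H => esym (mulB12_23 H))).
  by rewrite (iter_comm _ _ (fun H => esym (mulB12_13 H))).
have Etr k' : low_trunc3 (E k').
  rewrite /E; elim: p {AC E ES} => [|p IHp] /=; last exact: low_trunc3_mulB13.
  elim: q {BC} => [|q IHq] /=; last exact: low_trunc3_mulB23.
  move=> n; have [M HM] := ordered_prod_low_trunc A B k' (C n x).
  have [M' HM'] := ordered_prod_low_trunc A B k' x.
  exists (Num.max M M') => l m; rewrite ge_max => /andP[le1 le2].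
  by rewrite /K HM // HM' // raddf0 subrr.
have K0 : K 0 = (fun l m n => A l (commutator B C m n x))
              + (fun l m n => commutator A C l n (B m x)).
  apply/funext => l; apply/funext => m; apply/funext => n.
  by rewrite /K !fctE !ordered_prod0 /commutator raddfB addrA subrK.
have E0 : E 0 = 0.
  rewrite /E K0 (iter_raddfD (@mulB23 V)) (iter_raddfD (@mulB13 V)).
  rewrite [iter q _ (fun l m n => A l _)](_ : _ = 0); last first.
    apply/funext => l; apply/funext => m; apply/funext => n.
    by rewrite iter_mulB23 (iter_mulB_raddf (A l)) BC raddf0.
  rewrite iter_raddf0 add0r.
  rewrite iter_iter_comm; last exact: mulB13_23.
  rewrite [iter p _ (fun l m n => commutator A C l n _)](_ : _ = 0) ?iter_raddf0 //.
  apply/funext => l; apply/funext => m; apply/funext => n.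
  by rewrite iter_mulB13 AC.
apply/funext => l; apply/funext => m; apply/funext => n.
pose Fn k' := fun l m => E k' l m n.
suff /(_ k)/(congr1 (fun F : int -> int -> V => F l m)) : forall k', Fn k' = 0 by [].
apply: low_trunc_family0 => [k'|k'|].
- exact: Etr.
- by apply/funext => l'; apply/funext => m'; rewrite /Fn ES.
- by apply/funext => l'; apply/funext => m'; rewrite /Fn E0.
Qed.

(* Dong's lemma: z - x and z - w act nilpotently on (w - x)^q [(z - w)^k [A(z), B(w)], C(x)],
   hence so does their difference w - x. *)
Lemma nprod_local A B C k :
  mutually_local A B -> mutually_local A C -> mutually_local B C ->
  mutually_local (nprod A B k) C.
Proof.
move=> /expanded_comm_local[N AB] /mutually_localE[p AC] /mutually_localE[q BC].
(* Chosen so that k + j >= N, whence (z - w)^j kills [T k] below. *)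
pose j := `|N%:Z - k|%N.
apply/mutually_localE; exists (j + p + q)%N => x.
pose T k l m n := expanded_comm A B k l m (C n x) - C n (expanded_comm A B k l m x).
have TS k' : mulB12 (T k') = T (k' + 1).
  apply/funext => l; apply/funext => m; apply/funext => n.
  by rewrite /T /mulB12 !expanded_commS subrACA -(raddfB (C n)).
have Tj i : iter i (@mulB12 V) (T k) = T (k + i%:Z).
  elim: i => [|i /= ->]; first by rewrite addr0.
  by rewrite TS -addn1 PoszD addrA.
have Tk : iter p (@mulB13 V) (iter q (@mulB23 V) (T k)) = 0.
  have -> : T k = (fun l m n => ordered_prod A B k l m (C n x)
                                 - C n (ordered_prod A B k l m x))
      - (fun l m n => ordered_prod B A k m l (C n x)
                       - C n (ordered_prod B A k m l x)) *~ (- 1) ^ k.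
    apply/funext => l; apply/funext => m; apply/funext => n.
    rewrite /T /expanded_comm raddfB raddfMz subrACA -mulrzBl.
    by rewrite !fctE !fct_mulrzE.
  rewrite (iter_raddfB (@mulB23 V)) (iter_raddfB (@mulB13 V)).
  rewrite ordered_prod_comm_local // sub0r !iter_raddfMz.
  rewrite [X in - (X *~ _)](_ : _ = 0) ?mul0rz ?oppr0 //.
  (* The reversed product is handled by the same lemma with A, B and z, w exchanged. *)
  rewrite -[X in iter q _ X]/(swap12 (fun l m n => ordered_prod B A k l m (C n x)
                                               - C n (ordered_prod B A k l m x))).
  rewrite iter_mulB23_swap iter_mulB13_swap -iter_iter_comm; last exact: mulB13_23.
  by rewrite ordered_prod_comm_local.
have : iter (j + p) (@mulB23 V) (iter q (@mulB23 V) (T k)) = 0.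
  apply: nilpotent_sub Tk; [exact: mulB12_13|exact: mulB23E|].
  rewrite iter_iter_comm; last exact: mulB12_23.
  rewrite Tj [T _](_ : _ = 0) ?iter_raddf0 //.
  apply/funext => l; apply/funext => m; apply/funext => n.
  have le_Nj : N%:Z <= k + j%:Z by rewrite /j; lia.
  by rewrite /T !(AB _ le_Nj) raddf0 subrr.
(* At index 0 in z, [T k] is the commutator of [nprod A B k] with [C], and multiplication by w - x
   leaves that index alone. *)
rewrite -iterD => T0; apply/funext => m; apply/funext => n.
have := congr1 (fun H => H 0 m n) T0.
by rewrite iter_mulB23.
Qed.

End Products.

(** * Covariance under a Hasse-Schmidt sequence *)

Section Translation.
Variable V : zmodType.
Implicit Types (G : nat -> int -> V) (H : nat -> int -> int -> V).

(* A family G stands for the series \sum_(j, k) G j k y^j z^(-k-1);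
   [translate G] is its image under z |-> z + y, expanded in powers of y. *)
Definition translate G (m : nat) (k : int) : V :=
  \sum_(i < m.+1) G (m - i)%N (k - i%:Z) *~ binz (- (k - i%:Z) - 1) i.

(** Multiplication by y. *)
Definition delay G (m : nat) (k : int) : V := if m is m'.+1 then G m' k else 0.

Lemma translateB G G' m k :
  translate (fun j l => G j l - G' j l) m k = translate G m k - translate G' m k.
Proof. by rewrite -sumrB; apply: eq_bigr => i _; rewrite mulrzBl. Qed.

Lemma translateD G G' m k :
  translate (fun j l => G j l + G' j l) m k = translate G m k + translate G' m k.
Proof. by rewrite -big_split; apply: eq_bigr => i _; rewrite mulrzDl. Qed.

Lemma translateMz G (c : int) m k :
  translate (fun j l => G j l *~ c) m k = translate G m k *~ c.
Proof.
rewrite mulrz_suml; apply: eq_bigr => i _.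
by rewrite -!mulrzA mulrC.
Qed.

Lemma translate_raddf (f : {additive V -> V}) G m k :
  translate (fun j l => f (G j l)) m k = f (translate G m k).
Proof. by rewrite raddf_sum; apply: eq_bigr => i _; rewrite raddfMz. Qed.

Lemma eq_translate G G' m k : (forall j l, G j l = G' j l) ->
  translate G m k = translate G' m k.
Proof. by move=> eqG; apply: eq_bigr => i _; rewrite eqG. Qed.

Lemma translate_head G m k :
  (forall i, (0 < i <= m)%N ->
     G (m - i)%N (k - i%:Z) *~ binz (- (k - i%:Z) - 1) i = 0) ->
  translate G m k = G m k.
Proof.
move=> G0; rewrite /translate big_ord_recl /= subn0 subr0 binz0 mulr1z.
by rewrite big1 ?addr0 // => i _; rewrite G0 //= /bump add1n ltn_ord.
Qed.

(** Derivatives of positive order have no z^(-1) term, since binz (i - 1) i = 0 for i > 0; residues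
    are therefore translation invariant. *)
Lemma translate_at0 G m : translate G m 0 = G m 0.
Proof.
apply: translate_head => -[//|i] _.
have -> : - (0 - i.+1%:Z) - 1 = i%:Z by lia.
by rewrite binz_nat_gt.
Qed.

Lemma translate_delay G m k : translate (delay G) m k = delay (translate G) m k.
Proof.
rewrite /translate big_ord_recr /= subnn mul0rz addr0.
case: m => [|m]; first by rewrite big_ord0.
by apply: eq_bigr => i _; rewrite subSn // -ltnS.
Qed.

(** Translation turns a factor z into z + y. *)
Lemma translate_shift G m k :
  translate (fun j l => G j (l + 1)) m k
  = translate G m (k + 1) + delay (translate G) m k.
Proof.
rewrite /translate !big_ord_recl !subr0 !binz0 -addrA; congr (_ + _).
case: m => [|m]; first by rewrite !big_ord0 addr0.
rewrite /= -big_split; apply: eq_bigr => i _ /=.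
have -> : - (k - (bump 0 i)%:Z) - 1 = - (k + 1 - (bump 0 i)%:Z) - 1 + 1 by lia.
have -> : k - (bump 0 i)%:Z + 1 = k - i%:Z by rewrite /bump /=; lia.
have -> : k + 1 - (bump 0 i)%:Z = k - i%:Z by rewrite /bump /=; lia.
by rewrite /bump /= add1n binzS mulrzDr subSS.
Qed.

Definition translate2 H (m : nat) (l n : int) : V :=
  translate (fun j l' => translate (fun j' => H j' l') j n) m l.

(** Both variables move by the same y, so the two y-terms cancel and z - w is invariant. *)
Lemma translate2_mulB H m :
  translate2 (fun j => mulB (H j)) m = mulB (translate2 H m).
Proof.
apply/funext => l; apply/funext => n.
pose G n j l' := translate (fun j' => H j' l') j n.
transitivity (translate (fun j l' => G n j (l' + 1) - (G (n + 1) j l' + delay (G n) j l')) m l).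
  apply: eq_translate => j l'; rewrite translateB; congr (_ - _).
  by rewrite (translate_shift (fun j' => H j' l')); case: j.
rewrite translateB translateD (translate_shift (G n)) translate_delay.
by rewrite opprD addrACA subrr addr0.
Qed.

Lemma translate2_low_trunc H m :
  (forall j, low_trunc (H j)) -> low_trunc (translate2 H m).
Proof.
move=> trH.
have [M HM] : exists M : int, forall j l n, (j <= m)%N -> M <= n -> H j l n = 0.
  elim: m => [|m [M HM]].
    by have [M HM] := trH 0%N; exists M => j l n; rewrite leqn0 => /eqP ->; exact: HM.
  have [M' HM'] := trH m.+1; exists (Num.max M M') => j l n.
  rewrite leq_eqVlt ge_max ltnS => /orP[/eqP ->|le_jm] /andP[le1 le2].
    exact: HM'.
  exact: HM.
(* The inner translation lowers the index n by at most m. *)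
exists (M + m%:Z) => l n le_n; apply: big1 => i _; apply/eqP.
rewrite [translate _ _ _]big1 ?mul0rz // => j _.
rewrite HM ?mul0rz //; have := ltn_ord i; have := ltn_ord j; lia.
Qed.

End Translation.

Section Covariance.
Variables (V : zmodType) (D : nat -> {additive V -> V}).
Implicit Types A B : vfield V.

(** With D(y) = \sum_j D_j y^j this reads D(y) A(z) = A(z + y) D(y), compared at y^m. *)
Definition covariant A := forall m k x,
  D m (A k x) = translate (fun j l => A l (D j x)) m k.

(** For k = 0 covariance applies to A and then to B. Both sides respect multiplication by the
    invariant z - w, so [low_trunc_family0] gives all k. *)
Lemma ordered_prod_covariant A B : covariant A -> covariant B -> forall k m l n x,
  D m (ordered_prod A B k l n x)
  = translate2 (fun j l' n' => ordered_prod A B k l' n' (D j x)) m l n.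
Proof.
move=> covA covB k m l n x.
pose T k := translate2 (fun j l n => ordered_prod A B k l n (D j x)) m.
pose E k l n := D m (ordered_prod A B k l n x) - T k l n.
suff /(_ k)/(congr1 (fun F : int -> int -> V => F l n)) : forall k, E k = 0.
  by move=> /subr0_eq.
move=> {l n}; apply: low_trunc_family0 => [{}k|{}k|].
- have [M HM] := ordered_prod_low_trunc A B k x.
  have [M' HM'] : low_trunc (T k).
    by apply: translate2_low_trunc => j; exact: ordered_prod_low_trunc.
  exists (Num.max M M') => l n; rewrite ge_max => /andP[le1 le2].
  by rewrite /E HM // HM' // raddf0 subrr.
- have -> : E (k + 1) = fun l n => D m (ordered_prod A B (k + 1) l n x) - mulB (T k) l n.
    rewrite /E /T -translate2_mulB; apply/funext => l; apply/funext => n; congr (_ - _).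
    by do 2![apply: eq_translate => ? ?]; rewrite ordered_prodS.
  apply/funext => l; apply/funext => n.
  by rewrite ordered_prodS (raddfB (D m)) /mulB subrACA.
- apply/funext => l; apply/funext => n; apply/eqP; rewrite subr_eq0; apply/eqP.
  rewrite ordered_prod0 covA; apply: eq_translate => j l'.
  rewrite covB -translate_raddf; apply: eq_translate => j' n'.
  by rewrite ordered_prod0.
Qed.

Lemma nprod_covariant A B k : covariant A -> covariant B -> covariant (nprod A B k).
Proof.
move=> covA covB m n x; rewrite /= /nprod_coef /expanded_comm translateB translateMz.
(* The residue variable z is the outer one in the first [translate2] and the inner one in the
   second; removing its translation leaves that of w. *)
rewrite raddfB raddfMz !ordered_prod_covariant // /translate2 translate_at0.
by congr (_ - _ *~ _); apply: eq_translate => j l; rewrite translate_at0.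
Qed.

End Covariance.

(** * Zero, identity and difference fields *)

Section BasicFields.
Variable V : zmodType.
Implicit Types A B C : vfield V.

Lemma zero_field_trunc (b : V) : exists N : int, forall n : int, N <= n -> (\0 : V -> V) b = 0.
Proof. by exists 0. Qed.
Definition zero_field := VField (vcoef := fun=> \0) zero_field_trunc.

Lemma sub_field_trunc A B (b : V) :
  exists N : int, forall n : int, N <= n -> (A n \- B n) b = 0.
Proof.
have [M HM] := vcoef_trunc A b; have [N HN] := vcoef_trunc B b.
exists (Num.max M N) => n; rewrite ge_max => /andP[le1 le2].
by rewrite /= HM // HN // subrr.
Qed.
Definition sub_field A B := VField (vcoef := fun n => A n \- B n) (sub_field_trunc A B).

(** Index -1 belongs to z^0: this is the constant series Id, which becomes the field of the
    vacuum. *)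
Definition id_coef (n : int) : {additive V -> V} := 
  if n == -1 then (idfun : {additive V -> V}) else (\0 : {additive V -> V}).

Lemma id_field_trunc (b : V) :
  exists N : int, forall n : int, N <= n -> id_coef n b = 0.
Proof. by exists 0 => n le0n; rewrite /id_coef; case: eqP => // n1; lia. Qed.
Definition id_field := VField id_field_trunc.

Lemma eq_mutually_local A A' B :
  (forall n x, A n x = A' n x) -> mutually_local A B -> mutually_local A' B.
Proof.
move=> eqA /mutually_localE[t AB]; apply/mutually_localE; exists t => x.
rewrite -(AB x); congr iter; apply/funext => m; apply/funext => n.
by rewrite /commutator !eqA.
Qed.

Lemma zero_field_local B : mutually_local zero_field B.
Proof. by exists 0%N => m n x; rewrite /= /commutator /= raddf0 subrr. Qed.

Lemma id_field_local B : mutually_local id_field B.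
Proof.
exists 0%N => m n x; rewrite /= /commutator /= /id_coef.
by case: ifP => _ /=; rewrite ?raddf0 ?addr0 ?subrr.
Qed.

Lemma sub_field_local A B C :
  mutually_local A C -> mutually_local B C -> mutually_local (sub_field A B) C.
Proof.
move=> /mutually_localE[s AC] /mutually_localE[t BC].
apply/mutually_localE; exists (maxn s t) => x.
rewrite -[RHS](subrr 0) -{1}(iter_raddf_ge0 (leq_maxl s t) (AC x)).
rewrite -(iter_raddf_ge0 (leq_maxr s t) (BC x)) -iter_raddfB; congr iter.
apply/funext => m; apply/funext => n.
by rewrite !fctE /commutator /= raddfB subrACA.
Qed.

Section BasicCovariance.
Variable D : nat -> {additive V -> V}.

Lemma zero_field_covariant : covariant D zero_field.
Proof. by move=> m k x; rewrite raddf0 [RHS]big1 // => i _; rewrite mul0rz. Qed.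

Lemma id_field_covariant : covariant D id_field.
Proof.
move=> m k x; rewrite translate_head.
  by rewrite /= /id_coef; case: ifP => //= _; rewrite raddf0.
move=> i /andP[i_gt0 _]; rewrite /= /id_coef; case: eqP => [->|_]; last by rewrite mul0rz.
by rewrite opprK subrr binz_nat_gt.
Qed.

Lemma sub_field_covariant A B :
  covariant D A -> covariant D B -> covariant D (sub_field A B).
Proof. by move=> covA covB m k x; rewrite /= raddfB covA covB -translateB. Qed.

End BasicCovariance.
End BasicFields.

(** * The state-field correspondence *)

Lemma generates_ind (V : zmodType) (S : set V) (P : V -> Prop) :
  generates_additively S -> P 0 -> (forall x y, P x -> P y -> P (x - y)) ->
  (forall x, S x -> P x) -> forall x, P x.
Proof.
move=> genS P0 PB PS x; have : [set: V] x by [].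
rewrite -genS; apply: smallest_sub => //=.
split; first by rewrite inE.
by move=> y z; rewrite !inE; exact: PB.
Qed.

(** The recurrence gives r + 1 from r directly. Downwards, vanishing at r + 1 gives X(r, s, t) =
    -X(r, s - 1, t + 1), so t can be raised up to N, a bound uniform in r and s. *)
Lemma jacobi_defect0 (V : zmodType) (X : int -> int -> int -> V) :
  (forall r s t, X (r + 1) s t = X r (s + 1) t + X r s (t + 1)) ->
  (forall s t, X 0 s t = 0) ->
  (exists N : int, forall r s t, N <= t -> X r s t = 0) ->
  forall r s t, X r s t = 0.
Proof.
move=> XS X0 [N XN]; elim/int_ind => [//|r IHr|r IHr] s t.
  by rewrite -addn1 PoszD XS !IHr addr0.
have step s' t' : X (- r.+1%:Z) s' t' = - X (- r.+1%:Z) (s' - 1) (t' + 1).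
  apply/eqP; rewrite -subr_eq0 opprK; apply/eqP.
  have := XS (- r.+1%:Z) (s' - 1) t'; rewrite subrK => <-.
  by rewrite -addn1 PoszD opprD addrNK IHr.
suff vanish (j : nat) s' t' : N <= t' + j%:Z -> X (- r.+1%:Z) s' t' = 0.
  by apply: (vanish `|N - t|%N); lia.
elim: j s' t' => [|j IHj] s' t' le_N; first by apply: XN; lia.
by rewrite step IHj ?oppr0 //; lia.
Qed.

Section NProducts.
Variables (V : zmodType) (v0 : V).
Implicit Types A B : vfield V.

Definition creative A := forall n : int, 0 <= n -> A n v0 = 0.

Lemma creative_ordered_prod0 A B k l m : creative B -> 0 <= m ->
  ordered_prod A B k l m v0 = 0.
Proof.
move=> crB le0m; apply: fsbig1 => i _.
by rewrite crB ?raddf0 ?mul0rz //; lia.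
Qed.

Lemma nprod_creative A B k : creative A -> creative B -> creative (nprod A B k).
Proof.
move=> crA crB n le0n; rewrite /= /nprod_coef /expanded_comm.
by rewrite !creative_ordered_prod0 // mul0rz subrr.
Qed.

(** On [v0] the reversed product vanishes because it starts with A(i) v0, i >= 0; in the other one
    B(-1 + i) v0 leaves only i = 0. *)
Lemma nprod_create A B k : creative A -> creative B ->
  nprod A B k (- 1) v0 = A k (B (- 1) v0).
Proof.
move=> crA crB; rewrite /= /nprod_coef /expanded_comm.
rewrite [X in _ - X *~ _]creative_ordered_prod0 // mul0rz subr0.
rewrite /ordered_prod (@fsum_nat _ _ 1) => [|[//|i] _].
  by rewrite big_ord1 binz0 subr0 addr0 add0r mulr1z.
by rewrite crB ?raddf0 ?mul0rz //; lia.
Qed.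

(** As D_j kills [v0] for j > 0, only the term i = m of the translation survives, with coefficient
    binz m m = 1. *)
Lemma creative_covariant (D : nat -> {additive V -> V}) A m :
  (forall x, D 0%N x = x) -> (forall j, (0 < j)%N -> D j v0 = 0) ->
  creative A -> covariant D A -> A (- m%:Z - 1) v0 = D m (A (- 1) v0).
Proof.
move=> D0 Dv0 crA covA; rewrite covA /translate big_ord_recr /= big1 => [|i _].
  rewrite add0r subnn D0 (_ : - (-1 - m%:Z) - 1 = m%:Z); last by lia.
  by rewrite binz_nn mulr1z addrC.
by rewrite Dv0 ?raddf0 ?mul0rz // subn_gt0.
Qed.

Lemma expanded_commE A B r s t w :
  \sum_(i \in [set: nat])
     (A (r + t - i%:Z) (B (s + i%:Z) w)
      - B (s + t - i%:Z) (A (r + i%:Z) w) *~ ((- 1) ^ t)) *~ ((- 1) ^+ i * binz t i)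
  = expanded_comm A B t r s w.
Proof.
have [N HN] := coef_eventually0 B s w.
have [N' HN'] := coef_eventually0 A r w.
pose f i := A (r + t - i%:Z) (B (s + i%:Z) w) *~ ((- 1) ^+ i * binz t i).
pose g i := B (s + t - i%:Z) (A (r + i%:Z) w) *~ ((- 1) ^+ i * binz t i).
have f0 i : (maxn N N' <= i)%N -> f i = 0.
  by rewrite geq_max => /andP[le _]; rewrite /f HN ?raddf0 ?mul0rz.
have g0 i : (maxn N N' <= i)%N -> g i = 0.
  by rewrite geq_max => /andP[_ le]; rewrite /g HN' ?raddf0 ?mul0rz.
rewrite /expanded_comm [X in X - _](fsum_nat f0) [X in _ - X *~ _](fsum_nat g0).
rewrite mulrz_suml -sumrB (@fsum_nat _ _ (maxn N N')) => [|i le_i].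
  by apply: eq_bigr => i _; rewrite mulrzBl /g -!mulrzA [_ ^ t * _]mulrC.
move: le_i; rewrite geq_max => /andP[le_N le_N'].
by rewrite HN // HN' // (raddf0 (A _)) (raddf0 (B _)) mul0rz subrr mul0rz.
Qed.

End NProducts.

(** * Admissible fields and the vertex ring they define *)

Section Reconstruction.
Variables (V : zmodType) (v0 : V) (D : nat -> {additive V -> V}).
Hypotheses (D_0 : forall x : V, D 0%N x = x)
  (D_v0 : forall m : nat, (1 <= m)%N -> D m v0 = 0).
Variables (U : set V) (a : U -> vfield V).
Hypotheses (a_local : forall u v : U, mutually_local (a u) (a v))
  (a_creative : forall u : U, a u (- 1) v0 = set_val u /\ creative v0 (a u))
  (a_covariant : forall u : U, covariant D (a u))
  (a_generates : generates_additively (words (fun u : U => vcoef (a u)) v0)).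
Implicit Types A B : vfield V.

Definition admissible A :=
  [/\ forall u, mutually_local A (a u), creative v0 A & covariant D A].

Lemma admissible_gen u : admissible (a u).
Proof. by split => //; case: (a_creative u). Qed.

Lemma admissible_zero : admissible (zero_field V).
Proof.
by split=> [u|//|]; [exact: zero_field_local|exact: zero_field_covariant].
Qed.

Lemma admissible_id : admissible (id_field V).
Proof.
split=> [u|n le0n|]; [exact: id_field_local| |exact: id_field_covariant].
by rewrite /= /id_coef; case: eqP => // n1; lia.
Qed.

Lemma admissible_sub A B : admissible A -> admissible B -> admissible (sub_field A B).
Proof.
move=> [lA crA covA] [lB crB covB]; split=> [u|n le0n|].
- exact: sub_field_local.
- by rewrite /= crA ?crB ?subrr.
- exact: sub_field_covariant.
Qed.

Lemma admissible_nprod A B k : mutually_local A B ->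
  admissible A -> admissible B -> admissible (nprod A B k).
Proof.
move=> lAB [lA crA covA] [lB crB covB]; split=> [u||].
- exact: nprod_local.
- exact: nprod_creative.
- exact: nprod_covariant.
Qed.

(* Goddard's uniqueness argument: covariance gives A(z) v0 = 0, and locality
   moves A(z) to the right of the generating fields. *)
Lemma admissible_eq0 A : admissible A -> A (- 1) v0 = 0 -> forall n x, A n x = 0.
Proof.
move=> [lA crA covA] A0 n x; move: x n; apply: (generates_ind a_generates).
- by move=> n; rewrite raddf0.
- by move=> x y Ax Ay n; rewrite raddfB Ax Ay subrr.
move=> _ [s ->]; elim: s => [|[u k] s IHs] n /=.
  have [le0n|lt_n0] := lerP 0 n; first exact: crA.
  have -> : n = - `|(n + 1)%R|%N%:Z - 1 by lia.
  by rewrite (creative_covariant _ D_0 D_v0) // A0 raddf0.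
set x := foldr _ _ _ in IHs *.
have /mutually_localE[t /(_ x) Alocal] := lA u.
(* A(z) already kills the shorter word x, so the commutator on x reduces to A(z) u(w) x. This has
   finitely many negative powers of w, and a power of z - w kills it. *)
have F0 : (fun l m => A l (a u m x)) = 0.
  apply: (@low_trunc_iter_inj _ _ t).
    have [M HM] := vcoef_trunc (a u) x; exists M => l m le_Mm.
    by rewrite HM ?raddf0.
  rewrite -Alocal; congr iter; apply/funext => l; apply/funext => m.
  by rewrite /commutator IHs raddf0 subr0.
exact: (congr1 (fun F : int -> int -> V => F n k) F0).
Qed.

Lemma admissible_inj A B : admissible A -> admissible B ->
  A (- 1) v0 = B (- 1) v0 -> forall n x, A n x = B n x.
Proof.
move=> admA admB eqAB n x; apply: subr0_eq.
by apply: (admissible_eq0 (admissible_sub admA admB)) => /=; rewrite eqAB subrr.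
Qed.

(** Fields are built along words: the empty word comes from [id_field], and a further letter u(k)
    from the k-th product with u(z), by [nprod_create]. *)
Lemma admissible_exists v : exists A, admissible A /\ A (- 1) v0 = v.
Proof.
move: v; apply: (generates_ind a_generates).
- by exists (zero_field V); split; first exact: admissible_zero.
- move=> x y [A [admA Ax]] [B [admB By]]; exists (sub_field A B).
  by split; [exact: admissible_sub|rewrite /= Ax By].
move=> _ [s ->]; elim: s => [|[u k] s [A [admA As]]] /=.
  by exists (id_field V); split; first exact: admissible_id.
exists (nprod (a u) A k); split.
  apply: admissible_nprod => //; last exact: admissible_gen.
  by apply: mutually_local_sym; case: admA.
case: (admA) => _ crA _; have [_ cra] := a_creative u.
by rewrite (nprod_create k cra crA) As.
Qed.

Definition field_of (v : V) : vfield V := sval (cid (admissible_exists v)).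

Lemma field_of_admissible v : admissible (field_of v).
Proof. by rewrite /field_of; case: cid => A []. Qed.

Lemma field_of_create v : field_of v (- 1) v0 = v.
Proof. by rewrite /field_of; case: cid => A []. Qed.

Lemma field_of_creative v : creative v0 (field_of v).
Proof. by case: (field_of_admissible v). Qed.

Lemma field_of_eq A : admissible A -> forall n x, A n x = field_of (A (- 1) v0) n x.
Proof.
move=> admA; apply: admissible_inj => //; first exact: field_of_admissible.
by rewrite field_of_create.
Qed.

Lemma field_of_gen u n x : field_of (set_val u) n x = a u n x.
Proof.
by rewrite (field_of_eq (admissible_gen u)); case: (a_creative u) => ->.
Qed.

Lemma field_ofB u v n x : field_of (u - v) n x = field_of u n x - field_of v n x.
Proof.
have := field_of_eq (admissible_sub (field_of_admissible u) (field_of_admissible v)) n x.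
by rewrite /= !field_of_create.
Qed.

Lemma field_of0 n x : field_of 0 n x = 0.
Proof. by have := field_ofB 0 0 n x; rewrite !subrr. Qed.

Lemma field_ofD u v n x : field_of (u + v) n x = field_of u n x + field_of v n x.
Proof.
by have := field_ofB (u + v) v n x; rewrite addrK => ->; rewrite subrK.
Qed.

(** Admissibility gives locality to the generating fields only. Induction on the words giving v,
    with Dong's lemma at each letter, extends it to all pairs. *)
Lemma field_of_local u v : mutually_local (field_of v) (field_of u).
Proof.
move: v; apply: (generates_ind a_generates).
- by apply: (@eq_mutually_local _ (zero_field V)); [move=> n x; rewrite field_of0|exact: zero_field_local].
- move=> x y lx ly; apply: (eq_mutually_local _ (sub_field_local lx ly)) => n z.
  by rewrite field_ofB.
move=> _ [s ->]; elim: s => [|[w k] s IHs] /=.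
  apply: (eq_mutually_local _ (id_field_local _)) => n x.
  by rewrite (field_of_eq admissible_id).
set y := foldr _ _ _ in IHs *.
have [ly cry _] := field_of_admissible y; have [lu _ _] := field_of_admissible u.
have [_ crw] := a_creative w.
have lwy : mutually_local (a w) (field_of y) by exact: mutually_local_sym.
have lwu : mutually_local (a w) (field_of u) by exact: mutually_local_sym.
apply: (eq_mutually_local _ (nprod_local k lwy lwu IHs)) => n x.
rewrite (field_of_eq (admissible_nprod k lwy (admissible_gen w) (field_of_admissible y))).
by rewrite (nprod_create k crw cry) field_of_create.
Qed.

(** Both fields are admissible, the product because of [field_of_local], and both send [v0] to u(k)v
    at index -1. *)
Lemma field_of_nprod u v k n x :
  field_of (field_of u k v) n x = nprod (field_of u) (field_of v) k n x.
Proof.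
rewrite (field_of_eq (admissible_nprod k (field_of_local v u)
  (field_of_admissible u) (field_of_admissible v))).
by rewrite (nprod_create k (@field_of_creative u) (@field_of_creative v)) field_of_create.
Qed.

Lemma field_of_trunc (u v : V) :
  exists n0 : nat, forall n : int, n0%:Z <= n -> field_of u n v = 0.
Proof.
have [N HN] := vcoef_trunc (field_of u) v; exists `|N|%N => n le_n.
by apply: HN; lia.
Qed.

Lemma field_of_jacobi u v w r s t :
  \sum_(i \in [set: nat])
     field_of (field_of u (t + i%:Z) v) (r + s - i%:Z) w *~ binz r i
  = expanded_comm (field_of u) (field_of v) t r s w.
Proof.
pose L r s t := \sum_(i \in [set: nat])
  field_of (field_of u (t + i%:Z) v) (r + s - i%:Z) w *~ binz r i.
pose X r s t := L r s t - expanded_comm (field_of u) (field_of v) t r s w.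
suff /(_ r s t) /subr0_eq : forall r s t, X r s t = 0 by [].
move=> {r s t}; apply: jacobi_defect0 => [r s t|s t|].
- rewrite /X expanded_commS.
  have [N HN] := coef_eventually0 (field_of u) t v.
  have -> : L (r + 1) s t = L r (s + 1) t + L r s (t + 1).
    (* Pascal's rule in r gives the left-hand side the same recurrence that [expanded_commS] gives
       the right-hand side. *)
    rewrite /L (@fsum_binzS _ _ _ N) => [|i /HN ->]; last exact: field_of0.
    congr (_ + _); apply: eq_fsbigr => i _; congr (_ *~ _).
      by congr (vcoef _ _ _); lia.
    by congr (vcoef (field_of (vcoef _ _ _)) _ _); lia.
  by rewrite addrACA -opprD (addrC (expanded_comm _ _ _ _ (s + 1) _)) subrK.
- by rewrite /X /L fsum_binz0 addr0 subr0 add0r field_of_nprod subrr.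
have [N HN] := expanded_comm_local (field_of_local v u).
have [N' HN'] := field_of_trunc u v.
(* Beyond N the right-hand side vanishes by locality; beyond N' every u(t + i)v with i >= 0 is 0. *)
exists (maxn N N')%:Z => r s t le_t; rewrite /X HN; last by lia.
rewrite subr0; apply: fsbig1 => i _; rewrite HN'; last by lia.
by rewrite field_of0 mul0rz.
Qed.

Lemma field_of_vacuum u :
  field_of u (- 1) v0 = u /\ (forall n : int, 0 <= n -> field_of u n v0 = 0).
Proof. by split; [exact: field_of_create|exact: field_of_creative]. Qed.

(** Kept transparent by [Defined], so that its products and vacuum compute to [field_of] and
    [v0]. *)
Definition reconstructed : vertexRing V.
Proof.
refine (@VertexRing V (fun u => vcoef (field_of u)) v0 _ field_of_trunc field_of_vacuum _).
- by move=> n u v w; exact: field_ofD.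
- by move=> u v w r s t; rewrite expanded_commE; exact: field_of_jacobi.
Defined.

End Reconstruction.

Theorem theorem4p12 (V : zmodType) (v0 : V) (D : nat -> {additive V -> V})
  (D_0 : forall x : V, D 0%N x = x)
  (D_v0 : forall m : nat, (1 <= m)%N -> D m v0 = 0)
  (U : set V) (a : U -> vfield V)
  (a_local : forall u v : U, mutually_local (a u) (a v))
  (a_creative : forall u : U,
     a u (- 1) v0 = set_val u /\ (forall n : int, 0 <= n -> a u n v0 = 0))
  (a_hs : forall (u : U) (m : nat), (1 <= m)%N ->
     forall (k : int) (x : V),
       D m (a u k x) - a u k (D m x)
       = \sum_(1 <= i < m.+1) hs_deriv i (a u) k (D (m - i)%N x))
  (a_generates : generates_additively (words (fun u : U => vcoef (a u)) v0)) :
  exists W : vertexRing V,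
    [/\ vacuum W = v0,
        forall (u : U) (n : int) (x : V),
          state_field W (set_val u) n x = a u n x,
        forall (m : nat) (x : V), canonical_hs W m x = D m x
      & generated_by W U].
Proof.
(* The subtracted term of the commutator formula is the i = 0 term of the translation; the case m =
   0 is D_0 = Id. *)
have a_covariant u : covariant D (a u).
  move=> [|m] k x.
    by rewrite D_0 /translate big_ord1 subr0 binz0 mulr1z D_0.
  apply/eqP; rewrite /translate big_ord_recl subr0 binz0 mulr1z addrC -subr_eq.
  rewrite (a_hs u _ (ltn0Sn m)) big_add1 big_mkord; apply/eqP.
  by apply: eq_bigr => i _.
pose W := reconstructed D_0 D_v0 a_local a_creative a_covariant a_generates.
have WE (u : U) n x : vprod W (set_val u) n x = a u n x by exact: field_of_gen.
exists W; split => //.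
- move=> m x.
  (* The field of x sends [v0] to D_m x at index -m-1, because it sends [v0] to x at index -1. *)
  rewrite /canonical_hs (creative_covariant m D_0 D_v0) ?field_of_create //.
    exact: field_of_creative.
  by case: (field_of_admissible a_local a_creative a_covariant a_generates x).
- suff wordsE : words (fun u : U => vprod W (set_val u)) v0
                = words (fun u : U => vcoef (a u)) v0 by rewrite /generated_by wordsE.
  by apply/seteqP; split=> _ [s ->]; exists s; elim: s => //= p s ->; rewrite WE.
Qed.
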